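(* Let $M>0$ and $\alpha\in(0,1]$, and let $f=h+\overline{g}\in\mathcal{P}_{\mathcal{H}}^0(\alpha,M)$ with $h(z)=z+\sum_{n=2}^\infty a_nz^n$ and $g(z)=\sum_{n=2}^\infty b_nz^n$ for $z\in\mathbb{D}$. Then for every $n\geq 2$, $$|b_n|\leq \frac{M-\alpha+1}{n+\alpha n(n-2)}.$$ The result is sharp: for each $n\ge 2$ the function $f(z)=z+\frac{M-\alpha+1}{n+\alpha n(n-2)}\overline{z^n}$ belongs to $\mathcal{P}_{\mathcal{H}}^0(\alpha,M)$ and attains equality.
   Context: $\mathbb{D}=\{z\in\mathbb{C}:|z|<1\}$. $\mathcal{H}$ is the class of complex-valued harmonic functions $f=h+\overline{g}$ in $\mathbb{D}$, with $h,g$ analytic in $\mathbb{D}$ and $h(0)=h'(0)-1=0$, $g(0)=0$. For $M>0$ and $\alpha\in(0,1]$, $\mathcal{P}_{\mathcal{H}}^0(\alpha,M)$ is the class of all $f=h+\overline{g}\in\mathcal{H}$ with $g'(0)=0$ and $$\mathrm{Re}\left((1-\alpha)h'(z)+\alpha zh''(z)\right)>-M+\left|(1-\alpha)g'(z)+\alpha zg''(z)\right|\quad\text{for all } z\in\mathbb{D}.$$ *)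

(* Defs.v *)
From Stdlib Require Import Reals.
From Coquelicot Require Import Coquelicot.
Open Scope R_scope.

Definition in_disk (z : C) : Prop := Cmod z < 1.

Definition analytic_on_disk (f : C -> C) : Prop :=
  forall z : C, in_disk z ->
    ex_derive (K := C_AbsRing) (V := C_NormedModule) f z.

(* [f = h + conj g] on the disk, with the normalisations of the class [H];
   such an [f] is automatically harmonic there. *)
Definition canonical_decomposition (f h g : C -> C) : Prop :=
  analytic_on_disk h /\ analytic_on_disk g /\
  (forall z : C, in_disk z -> f z = (h z + Cconj (g z))%C) /\
  h (RtoC 0) = RtoC 0 /\ C_derive h (RtoC 0) = RtoC 1 /\
  g (RtoC 0) = RtoC 0.

(* [C_derive] is total; it is the complex derivative at every point of complex
   differentiability.  For [k] analytic on the disk, so is [C_derive k], and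
   both derivatives below are therefore the genuine [k'] and [k'']. *)
Definition diff_op (alpha : R) (k : C -> C) (z : C) : C :=
  ((1 - RtoC alpha) * C_derive k z
   + RtoC alpha * z * C_derive (C_derive k) z)%C.

(* A function on the disk is represented by a total function on [C]; its values
   outside the disk play no role. *)
Definition class_PH0 (alpha M : R) (f : C -> C) : Prop :=
  exists h g : C -> C,
    canonical_decomposition f h g /\
    C_derive g (RtoC 0) = RtoC 0 /\
    forall z : C, in_disk z ->
      Re (diff_op alpha h z) > - M + Cmod (diff_op alpha g z).

(* [k z] is the sum of [c n * z ^ n] over [n >= 2], for all [z] in the disk. *)
Definition series_from_2 (c : nat -> C) (k : C -> C) : Prop :=
  forall z : C, in_disk z ->
    is_series (K := C_AbsRing) (V := C_NormedModule)
      (fun j : nat => (c (j + 2)%nat * Cpow z (j + 2))%C) (k z).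

Definition decomposition_with_coefficients
    (f h g : C -> C) (a b : nat -> C) : Prop :=
  canonical_decomposition f h g /\
  series_from_2 a (fun z : C => (h z - z)%C) /\
  series_from_2 b g.

Definition coefficient_bound (alpha M : R) (n : nat) : R :=
  (M - alpha + 1) / (INR n + alpha * INR n * (INR n - 2)).

Definition extremal (alpha M : R) (n : nat) (z : C) : C :=
  (z + RtoC (coefficient_bound alpha M n) * Cconj (Cpow z n))%C.

(* Main.v *)
Require Import Defs.
From Stdlib Require Import Reals Lra Lia Psatz.
From Coquelicot Require Import Coquelicot.
Open Scope R_scope.

(* Put [P z = (1 - alpha) h' z + alpha z h'' z] and
   [Q z = (1 - alpha) g' z + alpha z g'' z].  The coefficient of [z ^ (n - 1)]
   in [Q] is [(n + alpha n (n - 2)) b_n], and [P 0 = 1 - alpha].  Averaging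
   [Q z * conj z ^ (n - 1)] over a circle of radius [r < 1] extracts that
   coefficient, while [|Q| < Re P + M] bounds the average by [1 - alpha + M];
   let [r] tend to [1].  The average is taken over the [N]-th roots of unity,
   where it is exact on polynomials of degree less than [N], and the series are
   truncated uniformly on the circle, so no integral is needed.  The pair
   [(h, g)] is determined by [f] because an analytic function whose conjugate is
   analytic is constant. *)

(* Coquelicot's canonical structures hide the carrier [C] from [ring]. *)
Ltac C_ring :=
  repeat match goal with
  | |- context [@plus ?G ?a ?b] => change (@plus G a b) with (Cplus a b)
  | |- context [@opp ?G ?a] => change (@opp G a) with (Copp a)
  | |- context [@scal ?K ?V ?a ?b] => change (@scal K V a b) with (Cmult a b)
  end;
  match goal with |- @eq _ ?a ?b => change (@eq C a b) end; ring.

(** * Complex derivatives and complex series *)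

(** Later increments are estimated directly with [Cmod], so the filter form of [is_derive] is
    unfolded here once. *)
Lemma C_is_derive_iff (f : C -> C) (z l : C) :
  is_derive (K := C_AbsRing) (V := C_NormedModule) f z l <->
  (forall eps : R, 0 < eps -> exists delta : R, 0 < delta /\
     forall w : C, Cmod (w - z) < delta ->
       Cmod (f w - f z - l * (w - z)) <= eps * Cmod (w - z)).
Proof.
  split.
  - intros [_ H] eps He.
    destruct (H z (fun P HP => HP) (mkposreal _ He)) as [d Hd].
    exists d; split; [apply cond_pos|].
    intros w Hw.
    specialize (Hd w Hw); cbn in Hd.
    refine (Rle_trans _ _ _ _ Hd). right.
    change (Cmod (f w - f z - l * (w - z)) = Cmod (f w - f z - (w - z) * l)). f_equal; ring.
  - intros H; split; [apply is_linear_scal_l|].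
    intros x Hx.
    rewrite <- (is_filter_lim_locally_unique (K := C_AbsRing) (V := AbsRing_NormedModule C_AbsRing) z x Hx); clear x Hx.
    intros eps.
    destruct (H eps (cond_pos eps)) as [d [d0 Hd]].
    exists (mkposreal d d0); intros w Hw.
    specialize (Hd w Hw).
    change (Cmod (f w - f z - (w - z) * l) <= eps * Cmod (w - z)).
    refine (Rle_trans _ _ _ _ Hd). right.
    f_equal; ring.
Qed.

Lemma C_series_norm_le (a : nat -> C) (l : C) (b : nat -> R) (s : R) :
  is_series (K := C_AbsRing) (V := C_NormedModule) a l -> is_series b s ->
  (forall n, Cmod (a n) <= b n) -> Cmod l <= s.
Proof.
  intros Ha Hb Hab.
  assert (H1 : is_lim_seq (fun n => Cmod (sum_n (G := C_AbelianMonoid) a n)) (Cmod l)).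
  { unfold is_series in Ha.
    exact (filterlim_comp _ _ _ _ _ _ _ _ Ha
      (filterlim_norm (K := C_AbsRing) (V := C_NormedModule) l)). }
  refine (is_lim_seq_le _ (sum_n b) (Cmod l) s _ H1 Hb).
  intros n. eapply Rle_trans.
  apply (norm_sum_n_m (K := C_AbsRing) (V := C_NormedModule) a 0 n).
  apply sum_n_m_le. exact Hab.
Qed.

(** A term is the difference of two consecutive partial sums, which are bounded; hence the factor
    2. *)
Lemma C_series_terms_bounded (a : nat -> C) (l : C) :
  is_series (K := C_AbsRing) (V := C_NormedModule) a l ->
  exists B : R, forall n, Cmod (a n) <= B.
Proof.
  intros Ha.
  destruct (filterlim_bounded (K := C_AbsRing) (V := C_NormedModule) _ (ex_intro _ l Ha)) as [B HB].
  exists (2 * B); intros [|n].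
  - generalize (HB 0%nat) (Rle_trans _ _ _ (Cmod_ge_0 _) (HB 0%nat)).
    rewrite sum_O; change norm with Cmod; lra.
  - generalize (HB n) (HB (S n)). rewrite sum_Sn.
    set (S := sum_n _ n). change norm with Cmod. change (plus S (a (Datatypes.S n))) with (S + a (Datatypes.S n))%C.
    intros H1 H2.
    replace (a (Datatypes.S n)) with ((S + a (Datatypes.S n)) + - S)%C by ring.
    eapply Rle_trans; [apply Cmod_triangle|]. rewrite Cmod_opp. lra.
Qed.

(** * Power series on the disk and their termwise differentiation *)

Definition disk_series (c : nat -> C) (k : C -> C) : Prop :=
  forall z : C, in_disk z ->
    is_series (K := C_AbsRing) (V := C_NormedModule)
      (fun j : nat => (c j * Cpow z j)%C) (k z).

(** Convergence at the real point [(r + 1) / 2] bounds the terms there, so the radius is at least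
    that number, which exceeds [r]. Passing to the moduli [Cmod (c j)] makes the theory of real
    power series available. *)
Lemma disk_series_CV_radius (c : nat -> C) (k : C -> C) (r : R) :
  disk_series c k -> 0 <= r < 1 -> Rbar_lt (Rabs r) (CV_radius (fun j => Cmod (c j))).
Proof.
  intros H Hr.
  rewrite Rabs_pos_eq by lra.
  apply (Rbar_lt_le_trans _ ((r + 1) / 2)); [simpl; lra|].
  apply (proj1 (CV_radius_bounded (fun j => Cmod (c j)))).
  assert (Hd : in_disk (RtoC ((r + 1) / 2))).
  { unfold in_disk. rewrite Cmod_R, Rabs_pos_eq; lra. }
  specialize (H _ Hd).
  destruct (C_series_terms_bounded _ _ H) as [B HB].
  exists B. intros n. specialize (HB n).
  rewrite Cmod_mult, Cmod_pow, Cmod_R in HB.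
  rewrite (Rabs_pos_eq ((r + 1) / 2)) in HB by lra.
  rewrite Rabs_pos_eq; [exact HB|].
  apply Rmult_le_pos; [apply Cmod_ge_0|apply pow_le; lra].
Qed.

Lemma disk_series_abs (c : nat -> C) (k : C -> C) (r : R) :
  disk_series c k -> 0 <= r < 1 -> ex_series (fun j => Cmod (c j) * r ^ j).
Proof.
  intros H Hr.
  eapply ex_series_ext; [|apply CV_disk_inside, (disk_series_CV_radius c k r H Hr)].
  intros n; apply Rabs_pos_eq.
  apply Rmult_le_pos; [apply Cmod_ge_0|apply pow_le; lra].
Qed.

(** For [Cmod z <= r] the tail is dominated termwise by the tail of the real series of moduli at
    [r], which does not depend on [z]. *)
Lemma disk_series_uniform_tail (c : nat -> C) (k : C -> C) (r eps : R) :
  disk_series c k -> 0 <= r < 1 -> 0 < eps ->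
  exists K0 : nat, forall K : nat, (K0 <= K)%nat -> forall z : C, Cmod z <= r ->
    Cmod (k z - sum_n (G := C_AbelianMonoid) (fun j => (c j * Cpow z j)%C) K) <= eps.
Proof.
  intros H Hr He.
  destruct (disk_series_abs c k r H Hr) as [s Hs]; change R in (type of s).
  destruct (Hs _ (locally_ball s (mkposreal eps He))) as [K0 HK0].
  exists K0; intros K HK z Hz.
  apply Rle_trans with (s - sum_n (fun j => Cmod (c j) * r ^ j) K).
  - assert (Hd : in_disk z) by (unfold in_disk; lra).
    specialize (H z Hd).
    apply (C_series_norm_le (fun j => (c (S K + j)%nat * Cpow z (S K + j))%C) _
             (fun j => Cmod (c (S K + j)%nat) * r ^ (S K + j))).
    + apply (is_series_incr_n (K := C_AbsRing) (V := C_NormedModule)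
               (fun j => (c j * Cpow z j)%C)); [lia|].
      simpl pred.
      match goal with |- is_series _ ?x => replace x with (k z) end; [exact H|].
      change (k z = (k z - sum_n (G := C_AbelianMonoid) (fun j => (c j * Cpow z j)%C) K)
        + sum_n (G := C_AbelianMonoid) (fun j => (c j * Cpow z j)%C) K)%C. ring.
    + apply (is_series_incr_n (fun j => Cmod (c j) * r ^ j)); [lia|].
      simpl pred.
      match goal with |- is_series _ ?x => replace x with s end; [exact Hs|].
      assert (E : forall x y : R, x = x - y + y) by (intros; ring).
      refine (E s (sum_n (fun j => Cmod (c j) * r ^ j) K)).
    + intros n. rewrite Cmod_mult, Cmod_pow.
      apply Rmult_le_compat_l; [apply Cmod_ge_0|].
      apply pow_incr; split; [apply Cmod_ge_0|exact Hz].
  - specialize (HK0 K HK).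
    change (Rabs (sum_n (fun j => Cmod (c j) * r ^ j) K - s) < eps) in HK0.
    apply Rabs_def2 in HK0. lra.
Qed.

Definition derived_coef (c : nat -> C) (j : nat) : C := (RtoC (INR (S j)) * c (S j))%C.

(** Through this identity [CV_radius_derive] applies to complex coefficients. *)
Lemma Cmod_derived_coef (c : nat -> C) (j : nat) :
  Cmod (derived_coef c j) = PS_derive (fun i => Cmod (c i)) j.
Proof.
  unfold derived_coef, PS_derive.
  rewrite Cmod_mult, Cmod_R, Rabs_pos_eq; [reflexivity|apply pos_INR].
Qed.

(** Induction on the degree: the remainder of degree [n + 1] is [w] times that of degree [n], plus
    [n * z ^ (n - 1) * (w - z) ^ 2]. The constant is twice the sharp one; in this form the bounds
    are terms of a twice differentiated series. *)
Lemma Cpow_taylor_remainder (z w : C) (r : R) (j : nat) :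
  Cmod z <= r -> Cmod w <= r ->
  Cmod (Cpow w (j + 2) - Cpow z (j + 2) - RtoC (INR (j + 2)) * Cpow z (j + 1) * (w - z))
    <= INR (j + 1) * INR (j + 2) * r ^ j * (Cmod (w - z)) ^ 2.
Proof.
  intros Hz Hw.
  assert (Hr : 0 <= r) by (generalize (Cmod_ge_0 z); lra).
  assert (Hd := Cmod_ge_0 (w - z)).
  induction j as [|j IH].
  - replace (Cpow w (0 + 2) - Cpow z (0 + 2) - RtoC (INR (0 + 2)) * Cpow z (0 + 1) * (w - z))%C
      with ((w - z) * (w - z))%C by (simpl; rewrite RtoC_plus; ring).
    rewrite Cmod_mult. simpl. nra.
  - change (S j + 2)%nat with (S (j + 2)). change (S j + 1)%nat with (S (j + 1)).
    rewrite !S_INR, RtoC_plus, !Cpow_S.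
    revert IH. replace (j + 2)%nat with (S (j + 1)) by lia. rewrite !Cpow_S.
    set (n := INR (S (j + 1))). set (Z := Cpow z (j + 1)). set (W := Cpow w (j + 1)).
    replace (INR (j + 1)) with (n - 1) by (unfold n; rewrite S_INR; ring).
    intros IH.
    replace (w * (w * W) - z * (z * Z) - (n + 1) * (z * Z) * (w - z))%C
      with (w * (w * W - z * Z - n * Z * (w - z)) + n * Z * (w - z) * (w - z))%C by ring.
    eapply Rle_trans; [apply Cmod_triangle|].
    rewrite !Cmod_mult.
    assert (Hn : 1 <= n) by (unfold n; rewrite S_INR; generalize (pos_INR (j + 1)); lra).
    assert (HZ : Cmod Z <= r * r ^ j).
    { unfold Z. rewrite Cmod_pow, Nat.add_1_r. apply (pow_incr _ _ (S j)). split; [apply Cmod_ge_0|exact Hz]. }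
    rewrite Cmod_R, (Rabs_pos_eq n) by lra.
    apply Rle_trans with (r * ((n - 1) * n * r ^ j * Cmod (w - z) ^ 2)
      + n * (r * r ^ j) * Cmod (w - z) * Cmod (w - z)).
    + apply Rplus_le_compat.
      * apply Rmult_le_compat; [apply Cmod_ge_0|apply Cmod_ge_0|exact Hw|exact IH].
      * rewrite !(Rmult_assoc n). apply Rmult_le_compat_l; [lra|].
        rewrite !Rmult_assoc, <- (Rmult_assoc r).
        apply Rmult_le_compat_r; [nra|exact HZ].
    + simpl. assert (0 <= r * r ^ j * (Cmod (w - z) * Cmod (w - z))).
      { apply Rmult_le_pos; [apply (pow_le r (S j)); lra|nra]. }
      nra.
Qed.

(** Summing the remainder bounds of the powers gives an error of at most [B * Cmod (w - z) ^ 2],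
    where [B] is the twice differentiated series of moduli at a radius [r] between [Cmod z] and
    1. *)
Lemma disk_series_is_derive (c : nat -> C) (k : C -> C) (z : C) :
  disk_series c k -> in_disk z ->
  exists l : C,
    is_derive (K := C_AbsRing) (V := C_NormedModule) k z l /\
    is_series (K := C_AbsRing) (V := C_NormedModule)
      (fun j : nat => (derived_coef c j * Cpow z j)%C) l.
Proof.
  intros H Hz. unfold in_disk in Hz.
  assert (Hz0 := Cmod_ge_0 z).
  assert (Hs : ex_series (K := C_AbsRing) (V := C_NormedModule)
      (fun j : nat => (derived_coef c j * Cpow z j)%C)).
  { apply (ex_series_le (K := C_AbsRing) (V := C_CompleteNormedModule)) with
      (b := fun j => Rabs (PS_derive (fun i => Cmod (c i)) j * Cmod z ^ j)).
    - intros n. change norm with Cmod.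
      rewrite Cmod_mult, Cmod_derived_coef, Cmod_pow. apply Rle_abs.
    - apply CV_disk_inside. rewrite CV_radius_derive.
      apply (disk_series_CV_radius c k); [exact H|lra]. }
  destruct Hs as [l Hl].
  exists l; split; [|exact Hl].
  set (r := (Cmod z + 1) / 2).
  assert (Hr : 0 <= r < 1) by (unfold r; lra).
  assert (HB : ex_series (fun j => Rabs (PS_derive (PS_derive (fun i => Cmod (c i))) j * r ^ j))).
  { apply CV_disk_inside. rewrite !CV_radius_derive.
    apply (disk_series_CV_radius c k); [exact H|lra]. }
  destruct HB as [B HB]; change R in (type of B).
  apply C_is_derive_iff. intros eps He.
  assert (Hbound : forall w, Cmod w <= r ->
    Cmod (k w - k z - l * (w - z)) <= B * Cmod (w - z) ^ 2).
  { intros w Hw.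
    pose (E := fun j => (Cpow w (j + 2) - Cpow z (j + 2) - RtoC (INR (j + 2)) * Cpow z (j + 1) * (w - z))%C).
    apply (C_series_norm_le (fun j => c (j + 2)%nat * E j)%C _
      (fun j => Rabs (PS_derive (PS_derive (fun i => Cmod (c i))) j * r ^ j) * Cmod (w - z) ^ 2)).
    - assert (Hw' : in_disk w) by (unfold in_disk, r in *; lra).
      (* [F j] belongs to degree [j + 1] and [E j] to degree [j + 2]: the remainders of degrees 0
         and 1 vanish, and each shift of index drops one of them. *)
      pose (F := fun j => (c (S j) * (Cpow w (S j) - Cpow z (S j) - RtoC (INR (S j)) * Cpow z j * (w - z)))%C).
      assert (HF : is_series (K := C_AbsRing) (V := C_NormedModule) F (k w - k z - l * (w - z))%C).
      { assert (HG : is_series (K := C_AbsRing) (V := C_NormedModule)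
          (fun j => (c (S j) * Cpow w (S j) - c (S j) * Cpow z (S j))%C) (k w - k z)%C).
        { apply (is_series_incr_1 (K := C_AbsRing) (V := C_NormedModule)
            (fun j => (c j * Cpow w j - c j * Cpow z j)%C)).
          replace (plus (k w - k z)%C _) with (minus (k w) (k z)).
          - apply (is_series_minus (K := C_AbsRing) (V := C_NormedModule)); apply H; assumption.
          - change (k w - k z = (k w - k z) + (c 0%nat * 1 - c 0%nat * 1))%C. ring. }
        assert (HD := is_series_minus (K := C_AbsRing) (V := C_NormedModule) _ _ _ _ HG
          (is_series_scal (K := C_AbsRing) (V := C_NormedModule) (w - z)%C _ _ Hl)).
        replace (k w - k z - l * (w - z))%C with (plus (k w - k z)%C (opp (scal (w - z)%C l))).
        - eapply is_series_ext; [|exact HD].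
          intros j. unfold F, derived_coef.
          change (c (S j) * Cpow w (S j) - c (S j) * Cpow z (S j)
            - (w - z) * (INR (S j) * c (S j) * Cpow z j) =
            c (S j) * (Cpow w (S j) - Cpow z (S j) - INR (S j) * Cpow z j * (w - z)))%C. ring.
        - change (k w - k z - (w - z) * l = k w - k z - l * (w - z))%C. ring. }
      eapply is_series_ext; [|apply (is_series_incr_1 (K := C_AbsRing) (V := C_NormedModule) F)].
      + intros j. unfold F, E. replace (j + 2)%nat with (S (S j)) by lia.
        replace (j + 1)%nat with (S j) by lia. reflexivity.
      + replace (plus _ (F 0%nat)) with (k w - k z - l * (w - z))%C; [exact HF|].
        unfold F. change (k w - k z - l * (w - z) = k w - k z - l * (w - z)
          + c 1%nat * (w * 1 - z * 1 - 1 * 1 * (w - z)))%C. ring.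
    - apply is_series_scal_r. exact HB.
    - intros n. rewrite Cmod_mult.
      assert (HE : Cmod (E n) <= _) by (apply Cpow_taylor_remainder with (r := r); unfold r in *; lra).
      rewrite Rabs_pos_eq.
      2:{ apply Rmult_le_pos; [|apply pow_le; lra]. unfold PS_derive.
          repeat apply Rmult_le_pos; try apply pos_INR. apply Cmod_ge_0. }
      eapply Rle_trans; [apply Rmult_le_compat_l; [apply Cmod_ge_0|exact HE]|].
      right. unfold PS_derive.
      replace (S (S n)) with (n + 2)%nat by lia. replace (S n) with (n + 1)%nat by lia. ring. }
  (* A negative [B] would contradict the bound at the real point [w = r], which differs from [z]
     because [Cmod z < r]. *)
  assert (HB0 : 0 <= B).
  { destruct (Rle_dec 0 B) as [|HBn]; [assumption|exfalso].
    specialize (Hbound (RtoC r)). rewrite Cmod_R, Rabs_pos_eq in Hbound by lra.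
    specialize (Hbound (Rle_refl r)).
    assert (0 < Cmod (r - z)).
    { apply Cmod_gt_0. intros E. assert (Cmod r = Cmod z) by (f_equal; replace (RtoC r) with (r - z + z)%C by ring; rewrite E; ring).
      rewrite Cmod_R, Rabs_pos_eq in H0 by lra. unfold r in H0; lra. }
    generalize (Cmod_ge_0 (k r - k z - l * (r - z))).
    assert (0 < Cmod (r - z) ^ 2) by (apply pow_lt; assumption).
    nra. }
  (* The first bound keeps [w] in the disk of radius [r], the second gives
     [B * Cmod (w - z) <= eps]; [B + 1] avoids a division by zero. *)
  exists (Rmin (r - Cmod z) (eps / (B + 1))). split.
  { apply Rmin_glb_lt; [unfold r; lra|apply Rdiv_lt_0_compat; lra]. }
  intros w Hw.
  assert (Hw1 : Cmod w <= r).
  { replace w with ((w - z) + z)%C by ring. eapply Rle_trans; [apply Cmod_triangle|].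
    generalize (Rmin_l (r - Cmod z) (eps / (B + 1))). lra. }
  specialize (Hbound w Hw1).
  assert (B * Cmod (w - z) <= eps).
  { assert (Cmod (w - z) < eps / (B + 1)) by (eapply Rlt_le_trans; [exact Hw|apply Rmin_r]).
    apply Rle_trans with ((B + 1) * (eps / (B + 1))); [|right; field; lra].
    generalize (Cmod_ge_0 (w - z)). nra. }
  generalize (Cmod_ge_0 (w - z)). nra.
Qed.

Lemma disk_series_C_derive (c : nat -> C) (k : C -> C) :
  disk_series c k -> disk_series (derived_coef c) (C_derive k).
Proof.
  intros H z Hz.
  destruct (disk_series_is_derive c k z H Hz) as [l [Hd Hl]].
  rewrite (is_C_derive_unique _ _ _ Hd). exact Hl.
Qed.

(** At [m = n - 1] the factor of [c n] is [(1 + alpha * (n - 2)) * n], the denominator of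
    [coefficient_bound]. *)
Lemma disk_series_diff_op (alpha : R) (c : nat -> C) (k : C -> C) :
  disk_series c k ->
  disk_series (fun m => (RtoC (1 - alpha + alpha * INR m) * derived_coef c m)%C)
    (diff_op alpha k).
Proof.
  intros H z Hz.
  assert (H1 := disk_series_C_derive _ _ H).
  assert (H2 := disk_series_C_derive _ _ H1 z Hz). specialize (H1 z Hz).
  (* Multiplying the series of the second derivative by [z] shifts it by one index; the new term at
     index 0 is zero. *)
  pose (A := fun j => (INR j * derived_coef c j * Cpow z j)%C).
  assert (HA : is_series (K := C_AbsRing) (V := C_NormedModule) A (z * C_derive (C_derive k) z)%C).
  { apply (is_series_decr_1 (K := C_AbsRing) (V := C_NormedModule)).
    replace (plus _ _) with (scal z (C_derive (C_derive k) z)).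
    - eapply is_series_ext; [|apply (is_series_scal (K := C_AbsRing) (V := C_NormedModule)), H2].
      intros j. unfold A. change (scal z ?x) with (z * x)%C. unfold derived_coef. rewrite Cpow_S.
      C_ring.
    - unfold A. change (z * C_derive (C_derive k) z = z * C_derive (C_derive k) z + - (0 * derived_coef c 0%nat * 1))%C.
      ring. }
  assert (HS := is_series_plus (K := C_AbsRing) (V := C_NormedModule) _ _ _ _
    (is_series_scal (K := C_AbsRing) (V := C_NormedModule) (1 - alpha)%C _ _ H1)
    (is_series_scal (K := C_AbsRing) (V := C_NormedModule) (RtoC alpha) _ _ HA)).
  unfold diff_op.
  replace (_ + _)%C with (plus (scal (1 - alpha)%C (C_derive k z)) (scal (RtoC alpha) (z * C_derive (C_derive k) z)%C)).
  - eapply is_series_ext; [|exact HS].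
    intros j. unfold A. rewrite RtoC_plus, RtoC_minus, RtoC_mult.
    change ((1 - alpha) * (derived_coef c j * Cpow z j) + alpha * (INR j * derived_coef c j * Cpow z j) =
      (1 - alpha + alpha * INR j) * derived_coef c j * Cpow z j)%C. ring.
  - change ((1 - alpha) * C_derive k z + alpha * (z * C_derive (C_derive k) z) =
      (1 - alpha) * C_derive k z + alpha * z * C_derive (C_derive k) z)%C. ring.
Qed.

(** * Uniqueness of the decomposition into analytic and conjugate-analytic parts *)

Lemma in_disk_locally (z : C) : in_disk z ->
  exists d : R, 0 < d /\ forall w : C, Cmod (w - z) < d -> in_disk w.
Proof.
  intros Hz. unfold in_disk in *.
  exists (1 - Cmod z); split; [lra|].
  intros w Hw. replace w with ((w - z) + z)%C by ring.
  eapply Rle_lt_trans; [apply Cmod_triangle|]. lra.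
Qed.

(* Comparing the increments of [phi] in the directions [1] and [i] gives
   [a = conj b] and [a = - conj b]. *)
Lemma conj_analytic_derive_zero (phi psi : C -> C) (z a b : C) :
  in_disk z ->
  (forall w, in_disk w -> phi w = Cconj (psi w)) ->
  is_derive (K := C_AbsRing) (V := C_NormedModule) phi z a ->
  is_derive (K := C_AbsRing) (V := C_NormedModule) psi z b -> a = RtoC 0.
Proof.
  intros Hz Heq Ha Hb.
  apply Cmod_eq_0, Rle_antisym; [|apply Cmod_ge_0].
  apply le_epsilon. intros eps He. rewrite Rplus_0_l.
  rewrite C_is_derive_iff in Ha, Hb.
  assert (He2 : 0 < eps / 2) by lra.
  destruct (Ha _ He2) as [d1 [Hd1 H1]], (Hb _ He2) as [d2 [Hd2 H2]].
  destruct (in_disk_locally z Hz) as [d3 [Hd3 H3]].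
  set (t := Rmin d1 (Rmin d2 d3) / 2).
  assert (Ht : 0 < t /\ t < d1 /\ t < d2 /\ t < d3).
  { unfold t. generalize (Rmin_l d1 (Rmin d2 d3)) (Rmin_r d1 (Rmin d2 d3)) (Rmin_l d2 d3) (Rmin_r d2 d3).
    assert (0 < Rmin d1 (Rmin d2 d3)) by (repeat apply Rmin_glb_lt; assumption). lra. }
  destruct Ht as [Ht0 [Ht1 [Ht2 Ht3]]]. clearbody t.
  (* The increment of [phi] along [t * u] has two linear approximations, each with error at most
     [eps / 2 * t]; they are compared and [t] is cancelled. *)
  assert (Hdir : forall u, Cmod u = 1 -> Cmod (a * u - Cconj (b * u)) <= eps).
  { intros u Hu.
    assert (Hm : Cmod (z + t * u - z) = t).
    { replace (z + t * u - z)%C with (t * u)%C by ring.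
      rewrite Cmod_mult, Cmod_R, Hu, Rabs_pos_eq; lra. }
    specialize (H1 (z + t * u)%C). specialize (H2 (z + t * u)%C). specialize (H3 (z + t * u)%C).
    rewrite Hm in H1, H2, H3. specialize (H1 Ht1). specialize (H2 Ht2). specialize (H3 Ht3).
    rewrite <- Cmod_conj in H2. rewrite !Cminus_conj, <- !Heq, !Cmult_conj, !Cminus_conj in H2 by assumption.
    rewrite !Cplus_conj, !Cmult_conj in H2.
    apply Rmult_le_reg_l with t; [exact Ht0|].
    replace t with (Cmod t) at 1 by (rewrite Cmod_R, Rabs_pos_eq; lra).
    rewrite <- Cmod_mult, Cmult_conj.
    replace (Cconj t) with (RtoC t) in H2 by (apply injective_projections; simpl; ring).
    set (P := phi (z + t * u)%C) in *. set (P0 := phi z) in *.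
    replace (t * (a * u - Cconj b * Cconj u))%C with
      ((P - P0 - Cconj b * (Cconj z + t * Cconj u - Cconj z)) + - (P - P0 - a * (z + t * u - z)))%C by ring.
    eapply Rle_trans; [apply Cmod_triangle|]. rewrite Cmod_opp. lra. }
  assert (U1 := Hdir 1%C Cmod_1). assert (U2 := Hdir Ci Cmod_Ci).
  rewrite Cmult_conj in U1, U2.
  replace (a * 1 - Cconj b * Cconj 1)%C with (a - Cconj b)%C in U1
    by (replace (Cconj 1) with (RtoC 1) by (apply injective_projections; simpl; ring); ring).
  replace (a * Ci - Cconj b * Cconj Ci)%C with (Ci * (a + Cconj b))%C in U2
    by (replace (Cconj Ci) with (- Ci)%C by (apply injective_projections; simpl; ring); ring).
  rewrite Cmod_mult, Cmod_Ci in U2.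
  assert (2 * Cmod a <= 2 * eps); [|lra].
  replace 2 with (Cmod 2) at 1 by (rewrite Cmod_R, Rabs_pos_eq; lra).
  rewrite <- Cmod_mult. replace (2 * a)%C with ((a - Cconj b) + (a + Cconj b))%C by ring.
  eapply Rle_trans; [apply Cmod_triangle|]. lra.
Qed.

(** Along the segment from 0 to [z] the real and imaginary parts are real functions with zero
    derivative. *)
Lemma disk_derive_zero_const (phi : C -> C) :
  (forall w, in_disk w -> is_derive (K := C_AbsRing) (V := C_NormedModule) phi w (RtoC 0)) ->
  forall z, in_disk z -> phi z = phi (RtoC 0).
Proof.
  intros H z Hz.
  (* [p] stands for either the real or the imaginary part. *)
  assert (Hp : forall p : C -> R, (forall x y, p (x - y)%C = p x - p y) ->
    (forall x, Rabs (p x) <= Cmod x) -> p (phi z) = p (phi (RtoC 0))).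
  { intros p Hpm Hpn.
    replace (phi z) with (phi (1 * z)%C) by (f_equal; ring).
    replace (phi (RtoC 0)) with (phi (0 * z)%C) by (f_equal; ring).
    symmetry.
    apply (eq_is_derive (V := R_NormedModule) (fun t => p (phi (t * z)%C)) 0 1); [|lra].
    intros t Ht. apply is_derive_Reals. intros eps He.
    assert (Hd : in_disk (t * z)).
    { unfold in_disk in *. rewrite Cmod_mult, Cmod_R, Rabs_pos_eq by lra.
      generalize (Cmod_ge_0 z). nra. }
    assert (He2 : 0 < eps / 2) by lra.
    destruct (proj1 (C_is_derive_iff _ _ _) (H _ Hd) _ He2) as [d [Hd0 Hd1]].
    exists (mkposreal d Hd0). intros s Hs0 Hs. simpl in Hs.
    assert (Hm : Cmod ((t + s)%R * z - t * z) <= Rabs s).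
    { rewrite RtoC_plus. replace ((t + s) * z - t * z)%C with (s * z)%C by ring.
      rewrite Cmod_mult, Cmod_R. unfold in_disk in Hz. generalize (Rabs_pos s) (Cmod_ge_0 z); nra. }
    specialize (Hd1 ((t + s)%R * z)%C (Rle_lt_trans _ _ _ Hm Hs)).
    rewrite <- Hpm. change (zero : R) with 0. rewrite Rminus_0_r, Rabs_div by exact Hs0.
    assert (Hs1 := Rabs_pos_lt s Hs0).
    apply Rmult_lt_reg_r with (Rabs s); [exact Hs1|].
    unfold Rdiv; rewrite Rmult_assoc, Rinv_l, Rmult_1_r by lra.
    eapply Rle_lt_trans; [apply Hpn|].
    replace (phi _ - phi _)%C with (phi ((t + s)%R * z)%C - phi (t * z)%C - 0 * ((t + s)%R * z - t * z))%C by ring.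
    nra. }
  apply injective_projections.
  - apply (Hp fst); [reflexivity|]. intros x. apply re_le_Cmod.
  - apply (Hp snd); [reflexivity|]. intros x. eapply Rle_trans; [apply Rmax_r|apply Rmax_Cmod].
Qed.

(** Primes mark the second pair, not derivatives. Since [class_PH0] only asserts that some pair
    exists, its inequality must be carried over to the pair whose coefficients are given. The
    difference [h - h'] is analytic and is the conjugate of the analytic [g' - g], so it is
    constant, with value 0 at the origin. *)
Lemma canonical_decomposition_unique (f h g h' g' : C -> C) :
  canonical_decomposition f h g -> canonical_decomposition f h' g' ->
  forall z, in_disk z -> h z = h' z /\ g z = g' z.
Proof.
  intros [Ah [Ag [Ef [h0 [_ g0]]]]] [Ah' [Ag' [Ef' [h0' [_ g0']]]]].
  set (phi := fun w => (h w - h' w)%C). set (psi := fun w => (g' w - g w)%C).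
  assert (Heq : forall w, in_disk w -> phi w = Cconj (psi w)).
  { intros w Hw. unfold phi, psi. rewrite Cminus_conj.
    specialize (Ef w Hw). specialize (Ef' w Hw). rewrite Ef in Ef'.
    replace (h w) with ((h w + Cconj (g w)) - Cconj (g w))%C by ring. rewrite Ef'. ring. }
  assert (Hphi : forall w, in_disk w -> is_derive (K := C_AbsRing) (V := C_NormedModule) phi w (RtoC 0)).
  { intros w Hw.
    destruct (Ah w Hw) as [a Ha], (Ag w Hw) as [b Hb], (Ah' w Hw) as [a' Ha'], (Ag' w Hw) as [b' Hb'].
    assert (D1 := is_derive_minus _ _ _ _ _ Ha Ha').
    assert (D2 := is_derive_minus _ _ _ _ _ Hb' Hb).
    rewrite <- (conj_analytic_derive_zero phi psi w _ _ Hw Heq D1 D2) at 1. exact D1. }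
  assert (Hh : forall w, in_disk w -> h w = h' w).
  { intros w Hw. assert (E := disk_derive_zero_const phi Hphi w Hw). unfold phi in E.
    rewrite h0, h0' in E. replace (h w) with ((h w - h' w) + h' w)%C by ring. rewrite E. ring. }
  intros z Hz. split; [apply Hh, Hz|].
  specialize (Ef z Hz). specialize (Ef' z Hz). rewrite Ef, (Hh z Hz) in Ef'.
  rewrite <- (Cconj_conj (g z)), <- (Cconj_conj (g' z)). f_equal.
  replace (Cconj (g z)) with ((h' z + Cconj (g z)) - h' z)%C by ring. rewrite Ef'. ring.
Qed.

(** * Roots of unity and discrete extraction of coefficients *)

Definition cis (t : R) : C := (cos t, sin t).

Lemma cis_plus (s t : R) : cis (s + t) = (cis s * cis t)%C.
Proof.
  apply injective_projections; simpl; [rewrite cos_plus|rewrite sin_plus]; ring.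
Qed.

Lemma cis_0 : cis 0 = RtoC 1.
Proof. unfold cis. rewrite cos_0, sin_0. reflexivity. Qed.

Lemma cis_pow (t : R) (n : nat) : Cpow (cis t) n = cis (INR n * t).
Proof.
  induction n as [|n IH].
  - simpl INR. rewrite Rmult_0_l, cis_0. reflexivity.
  - rewrite Cpow_S, IH, <- cis_plus. f_equal. rewrite S_INR. ring.
Qed.

Lemma Cmod_cis (t : R) : Cmod (cis t) = 1.
Proof.
  unfold Cmod, cis; simpl. rewrite !Rmult_1_r, Rplus_comm.
  change (sqrt (Rsqr (sin t) + Rsqr (cos t)) = 1). rewrite sin2_cos2. apply sqrt_1.
Qed.

(** The real part is [1 - 2 * sin (t / 2) ^ 2], and the sine is positive on [(0, PI)]. *)
Lemma cis_neq_1 (t : R) : 0 < t < 2 * PI -> cis t <> RtoC 1.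
Proof.
  intros Ht E. apply (f_equal fst) in E. simpl in E.
  assert (Hs : 0 < sin (t / 2)) by (apply sin_gt_0; lra).
  replace t with (2 * (t / 2)) in E by field. rewrite cos_2a_sin in E. nra.
Qed.

Definition unity_root (N : nat) : C := cis (2 * PI / INR N).

Lemma unity_root_pow_N (N : nat) : (0 < N)%nat -> Cpow (unity_root N) N = RtoC 1.
Proof.
  intros HN. unfold unity_root. rewrite cis_pow.
  replace (INR N * (2 * PI / INR N)) with (2 * PI) by (field; apply not_0_INR; lia).
  unfold cis. rewrite cos_2PI, sin_2PI. reflexivity.
Qed.

Lemma unity_root_primitive (N j : nat) :
  (0 < j < N)%nat -> Cpow (unity_root N) j <> RtoC 1.
Proof.
  intros [Hj HN]. unfold unity_root. rewrite cis_pow. apply cis_neq_1.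
  assert (Hj' := lt_INR _ _ Hj). assert (HN' := lt_INR _ _ HN). simpl in Hj'.
  assert (HP := PI_RGT_0).
  replace (INR j * (2 * PI / INR N)) with (2 * PI * (INR j / INR N)) by (field; lra).
  assert (0 < INR j / INR N) by (apply Rdiv_lt_0_compat; lra).
  assert (INR j / INR N < 1).
  { apply Rmult_lt_reg_r with (INR N); [lra|]. unfold Rdiv. rewrite Rmult_assoc, Rinv_l; lra. }
  nra.
Qed.

Lemma C_sum_n_mult_l (a : C) (u : nat -> C) (n : nat) :
  sum_n (G := C_AbelianMonoid) (fun k => (a * u k)%C) n
  = (a * sum_n (G := C_AbelianMonoid) u n)%C.
Proof. exact (sum_n_mult_l (K := C_Ring) a u n). Qed.

Lemma C_sum_n_const (a : C) (n : nat) :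
  sum_n (G := C_AbelianMonoid) (fun _ => a) n = (INR (S n) * a)%C.
Proof.
  induction n as [|n IH].
  - rewrite sum_O. simpl INR. C_ring.
  - rewrite sum_Sn, IH, (S_INR (S n)), RtoC_plus. C_ring.
Qed.

Lemma C_geometric_sum (x : C) (n : nat) :
  ((x - 1) * sum_n (G := C_AbelianMonoid) (Cpow x) n = Cpow x (S n) - 1)%C.
Proof.
  induction n as [|n IH].
  - rewrite sum_O. simpl. C_ring.
  - rewrite sum_Sn. change (plus ?a ?b) with (a + b)%C.
    rewrite Cmult_plus_distr_l, IH, !Cpow_S. C_ring.
Qed.

Lemma C_sum_n_single (u : nat -> C) (n K : nat) :
  (n <= K)%nat -> (forall m, (m <= K)%nat -> m <> n -> u m = RtoC 0) ->
  sum_n (G := C_AbelianMonoid) u K = u n.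
Proof.
  assert (Hz : forall K, (forall m, (m <= K)%nat -> u m = RtoC 0) ->
    sum_n (G := C_AbelianMonoid) u K = RtoC 0).
  { intros k; induction k as [|k IH]; intros H.
    - rewrite sum_O. apply H; lia.
    - rewrite sum_Sn, IH, H by (intros; try apply H; lia). C_ring. }
  induction K as [|K IH]; intros HnK Hu.
  - rewrite sum_O. f_equal; lia.
  - rewrite sum_Sn. destruct (Nat.eq_dec n (S K)) as [->|Hne].
    + rewrite Hz by (intros; apply Hu; lia). C_ring.
    + rewrite IH by (intros; try apply Hu; lia). rewrite (Hu (S K)) by lia. C_ring.
Qed.

(* Since [n, m <= K <= L], the exponent [m + (S L - n)] is divisible by [S L]
   only for [m = n]. *)
Lemma unity_root_coefficient (q : nat -> C) (r : R) (n K L : nat) :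
  (n <= K)%nat -> (K <= L)%nat ->
  sum_n (G := C_AbelianMonoid) (fun k =>
    (Cpow (Cpow (unity_root (S L)) k) (S L - n) *
     sum_n (G := C_AbelianMonoid)
       (fun m => q m * Cpow (RtoC r * Cpow (unity_root (S L)) k) m) K)%C) L
  = (INR (S L) * (q n * RtoC (r ^ n)))%C.
Proof.
  intros Hn HK. set (w := unity_root (S L)).
  assert (HwN : Cpow w (S L) = RtoC 1) by (apply unity_root_pow_N; lia).
  transitivity (sum_n (G := C_AbelianMonoid) (fun k => sum_n (G := C_AbelianMonoid)
    (fun m => q m * RtoC (r ^ m) * Cpow (Cpow w (m + (S L - n))) k)%C K) L).
  { apply sum_n_ext. intros k. rewrite <- C_sum_n_mult_l. apply sum_n_ext. intros m.
    rewrite Cpow_mult_l, <- RtoC_pow, <- !Cpow_mult_r.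
    rewrite Nat.mul_add_distr_r, Cpow_add_r, (Nat.mul_comm k m), (Nat.mul_comm k (S L - n)). C_ring. }
  (* After the exchange, the sum over [k] is geometric with ratio [w ^ (m + (S L - n))]. This ratio
     is an [S L]-th root of unity, so the sum vanishes unless the ratio is 1. *)
  rewrite sum_n_switch.
  rewrite (C_sum_n_single _ n K Hn).
  - rewrite C_sum_n_mult_l.
    replace (n + (S L - n))%nat with (S L) by lia. rewrite HwN.
    rewrite (sum_n_ext _ (fun _ => RtoC 1)) by (intros; apply Cpow_1_l).
    rewrite C_sum_n_const. C_ring.
  - intros m Hm Hmn. rewrite C_sum_n_mult_l.
    set (x := Cpow w (m + (S L - n))).
    assert (Hx : x <> RtoC 1).
    { unfold x. destruct (Nat.lt_ge_cases m n).
      - apply unity_root_primitive; lia.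
      - replace (m + (S L - n))%nat with (S L + (m - n))%nat by lia.
        rewrite Cpow_add_r, HwN, Cmult_1_l. apply unity_root_primitive; lia. }
    assert (HG := C_geometric_sum x L).
    replace (Cpow x (S L)) with (RtoC 1) in HG
      by (unfold x; rewrite <- Cpow_mult_r, Nat.mul_comm, Cpow_mult_r, HwN, Cpow_1_l; reflexivity).
    replace (sum_n (G := C_AbelianMonoid) (Cpow x) L) with (RtoC 0); [C_ring|].
    symmetry. assert (Hx' : (x - 1)%C <> RtoC 0).
    { intros E. apply Hx. replace x with ((x - 1) + 1)%C by ring. rewrite E. ring. }
    set (T := sum_n _ _) in *. replace T with (/ (x - 1) * ((x - 1) * T))%C by (field; exact Hx').
    rewrite HG. ring.
Qed.

Lemma Re_sum_n (u : nat -> C) (n : nat) :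
  Re (sum_n (G := C_AbelianMonoid) u n) = sum_n (fun k => Re (u k)) n.
Proof.
  induction n as [|n IH]; [rewrite !sum_O; reflexivity|].
  rewrite !sum_Sn, <- IH. reflexivity.
Qed.

(** * The coefficient bound *)

Lemma dominated_coefficient_bound (p q : nat -> C) (P Q : C -> C) (M : R) (n : nat) :
  disk_series p P -> disk_series q Q ->
  (forall z, in_disk z -> Re (P z) > - M + Cmod (Q z)) ->
  Cmod (q n) <= M + Re (p 0%nat).
Proof.
  intros HP HQ H.
  assert (Hr : forall r, 0 <= r < 1 -> Cmod (q n) * r ^ n <= M + Re (p 0%nat)).
  { intros r Hr. apply le_epsilon. intros eps He.
    assert (He2 : 0 < eps / 2) by lra.
    destruct (disk_series_uniform_tail p P r _ HP Hr He2) as [K1 HK1].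
    destruct (disk_series_uniform_tail q Q r _ HQ Hr He2) as [K2 HK2].
    (* [K] is the degree of both truncations, and [S K] nodes suffice for exact averages up to that
       degree. *)
    set (K := (K1 + K2 + n)%nat).
    specialize (HK1 K ltac:(unfold K; lia)). specialize (HK2 K ltac:(unfold K; lia)).
    set (w := unity_root (S K)).
    assert (Hw : forall k, Cmod (Cpow w k) = 1).
    { intros k. rewrite Cmod_pow. unfold w, unity_root. rewrite Cmod_cis. apply pow1. }
    set (PK := fun k => sum_n (G := C_AbelianMonoid) (fun m => (p m * Cpow (RtoC r * Cpow w k) m)%C) K).
    set (QK := fun k => sum_n (G := C_AbelianMonoid) (fun m => (q m * Cpow (RtoC r * Cpow w k) m)%C) K).
    (* The hypothesis survives truncation at the nodes, with a loss of [eps / 2] from each of the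
       two series. *)
    assert (Hpt : forall k, Cmod (QK k) <= Re (PK k) + (M + eps)).
    { intros k. set (z := (RtoC r * Cpow w k)%C).
      assert (Hz : Cmod z = r) by (unfold z; rewrite Cmod_mult, Hw, Cmod_R, Rabs_pos_eq; lra).
      specialize (HK1 z (Req_le _ _ Hz)). specialize (HK2 z (Req_le _ _ Hz)).
      specialize (H z). unfold in_disk in H. rewrite Hz in H. specialize (H (proj2 Hr)).
      change (Cmod (P z - PK k) <= eps / 2) in HK1.
      change (Cmod (Q z - QK k) <= eps / 2) in HK2.
      assert (A1 := Rle_trans _ _ _ (re_le_Cmod _) HK1).
      change (Rabs (Re (P z) - Re (PK k)) <= eps / 2) in A1.
      apply Rabs_le_between in A1.
      assert (A2 : Cmod (QK k) <= Cmod (Q z) + eps / 2).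
      { replace (QK k) with (Q z + - (Q z - QK k))%C by ring.
        eapply Rle_trans; [apply Cmod_triangle|]. rewrite Cmod_opp. lra. }
      lra. }
    (* As [w ^ S K = 1], the weight [w ^ (k * (S K - n))] is the conjugate of [w ^ (k * n)]. For
       [n = 0] it is 1, so the second identity is the plain average of [PK]. *)
    assert (EQ := unity_root_coefficient q r n K K ltac:(unfold K; lia) (le_n K)).
    assert (EP := unity_root_coefficient p r 0 K K ltac:(lia) (le_n K)).
    fold w in EP, EQ.
    assert (EP' : sum_n (fun k => Re (PK k)) K = INR (S K) * Re (p 0%nat)).
    { rewrite <- Re_sum_n. transitivity (Re (INR (S K) * (p 0%nat * RtoC (r ^ 0)))%C).
      - rewrite <- EP. f_equal. apply sum_n_ext. intros k. unfold PK.
        rewrite Nat.sub_0_r, <- Cpow_mult_r, Nat.mul_comm, Cpow_mult_r.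
        unfold w. rewrite unity_root_pow_N, Cpow_1_l by lia. symmetry. apply Cmult_1_l.
      - rewrite pow_O, Cmult_1_r. unfold Re, Cmult, RtoC; cbn [fst snd].
        rewrite Rmult_0_l, Rminus_0_r. reflexivity. }
    assert (HN : 0 < INR (S K)) by (apply lt_0_INR; lia).
    apply Rmult_le_reg_l with (INR (S K)); [exact HN|].
    apply Rle_trans with (Cmod (INR (S K) * (q n * RtoC (r ^ n)))).
    { right. rewrite !Cmod_mult, !Cmod_R, !Rabs_pos_eq; [reflexivity|apply pow_le; lra|lra]. }
    rewrite <- EQ.
    eapply Rle_trans; [apply (norm_sum_n_m (K := C_AbsRing) (V := C_NormedModule))|].
    apply Rle_trans with (sum_n (fun k => Re (PK k) + (M + eps)) K).
    - apply sum_n_m_le. intros k. change norm with Cmod. fold (QK k).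
      rewrite Cmod_mult, Cmod_pow, Hw, pow1, Rmult_1_l. apply Hpt.
    - change (fun k => Re (PK k) + (M + eps)) with (fun k => plus (Re (PK k)) (M + eps)).
      rewrite sum_n_plus, sum_n_const, EP'. right.
      change (INR (S K) * Re (p 0%nat) + INR (S K) * (M + eps) = INR (S K) * (M + Re (p 0%nat) + eps)). ring. }
  (* The limit as [r] tends to 1 is made explicit: [r = 1 - d] and Bernoulli's inequality
     [(1 - d) ^ n >= 1 - n * d]. The choice of [B] gives both [d < 1] and [A * n * d <= eps]. *)
  apply le_epsilon. intros eps He.
  set (A := Cmod (q n)) in *. assert (HA : 0 <= A) by apply Cmod_ge_0.
  set (B := A * INR n + eps + 1). assert (Hn := pos_INR n).
  assert (HB : 0 < B) by (unfold B; nra).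
  set (d := eps / B).
  assert (Hd : 0 < d < 1).
  { unfold d; split; [apply Rdiv_lt_0_compat; lra|].
    apply Rmult_lt_reg_r with B; [lra|]. unfold Rdiv. rewrite Rmult_assoc, Rinv_l by lra. unfold B; nra. }
  assert (HdB : d * B = eps) by (unfold d; field; lra).
  clearbody d.
  specialize (Hr (1 - d) ltac:(lra)).
  assert (Hbern : 1 - INR n * d <= (1 - d) ^ n).
  { clear - Hd. induction n as [|n IH]; [simpl; lra|]. rewrite S_INR. simpl.
    assert (Hn := pos_INR n). assert (0 <= INR n * d * d) by (repeat apply Rmult_le_pos; lra).
    apply Rle_trans with ((1 - d) * (1 - INR n * d)); [lra|].
    apply Rmult_le_compat_l; [lra|exact IH]. }
  assert (A * (1 - INR n * d) <= A * (1 - d) ^ n) by (apply Rmult_le_compat_l; assumption).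
  unfold B in HdB. nra.
Qed.

Lemma C_is_series_single (u : nat -> C) (n : nat) :
  (forall m, m <> n -> u m = RtoC 0) ->
  is_series (K := C_AbsRing) (V := C_NormedModule) u (u n).
Proof.
  intros Hu. unfold is_series.
  apply (filterlim_ext_loc (fun _ => u n)); [|apply filterlim_const].
  exists n. intros K HK. symmetry. apply C_sum_n_single; [exact HK|].
  intros m _ Hm. exact (Hu m Hm).
Qed.

(** [series_from_2] leaves [c 0] and [c 1] arbitrary, so they are overwritten; the head [e] is 1 for
    [h] and 0 for [g]. *)
Definition coef_with_head (e : C) (c : nat -> C) (j : nat) : C :=
  match j with O => RtoC 0 | S O => e | _ => c j end.

Lemma series_from_2_disk_series (e : C) (c : nat -> C) (k : C -> C) :
  series_from_2 c k -> disk_series (coef_with_head e c) (fun z => (e * z + k z)%C).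
Proof.
  intros H z Hz. specialize (H z Hz).
  apply (is_series_decr_n (K := C_AbsRing) (V := C_NormedModule) _ 2); [lia|].
  simpl pred. rewrite sum_Sn, sum_O.
  replace (plus _ _) with (k z) by (simpl; C_ring).
  eapply is_series_ext; [|exact H].
  intros j. cbv beta. rewrite (Nat.add_comm j). reflexivity.
Qed.

Lemma disk_series_ext (c : nat -> C) (k k' : C -> C) :
  (forall z, in_disk z -> k z = k' z) -> disk_series c k -> disk_series c k'.
Proof.
  intros E H z Hz. rewrite <- (E z Hz). exact (H z Hz).
Qed.

Lemma coefficient_denominator_pos (alpha : R) (n : nat) :
  0 < alpha -> (2 <= n)%nat -> 0 < INR n + alpha * INR n * (INR n - 2).
Proof.
  intros Ha Hn. apply le_INR in Hn. simpl in Hn.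
  assert (0 <= alpha * INR n * (INR n - 2)) by (repeat apply Rmult_le_pos; lra). lra.
Qed.

Lemma class_PH0_coefficient_bound (alpha M : R) (f h g : C -> C) (a b : nat -> C) (n : nat) :
  0 < alpha -> class_PH0 alpha M f -> decomposition_with_coefficients f h g a b ->
  (2 <= n)%nat -> Cmod (b n) <= coefficient_bound alpha M n.
Proof.
  intros Ha [h' [g' [Hdec' [_ Hineq]]]] [Hdec [Hser_h Hser_g]] Hn.
  assert (Huniq := canonical_decomposition_unique f h g h' g' Hdec Hdec').
  assert (Hh : disk_series (coef_with_head 1 a) h').
  { eapply disk_series_ext; [|apply (series_from_2_disk_series _ _ _ Hser_h)].
    intros z Hz. simpl. rewrite <- (proj1 (Huniq z Hz)). ring. }
  assert (Hg : disk_series (coef_with_head 0 b) g').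
  { eapply disk_series_ext; [|apply (series_from_2_disk_series _ _ _ Hser_g)].
    intros z Hz. simpl. rewrite <- (proj2 (Huniq z Hz)). ring. }
  (* Differentiation lowers the degree by one, so [b n] sits at index [n - 1]; the constant term on
     the other side is [1 - alpha]. *)
  assert (Hmain := dominated_coefficient_bound _ _ _ _ M (n - 1)
    (disk_series_diff_op alpha _ _ Hh) (disk_series_diff_op alpha _ _ Hg) Hineq).
  assert (Hpos := coefficient_denominator_pos alpha n Ha Hn).
  unfold derived_coef in Hmain.
  replace (S (n - 1)) with n in Hmain by lia.
  replace (coef_with_head 0 b n) with (b n) in Hmain by (destruct n as [|[|n]]; [lia|lia|reflexivity]).
  rewrite !Cmod_mult, !Cmod_R, minus_INR in Hmain by lia.
  assert (Hn2 := le_INR _ _ Hn). simpl in Hn2.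
  rewrite (Rabs_pos_eq (INR n)) in Hmain by lra.
  simpl INR in Hmain.
  rewrite Rabs_pos_eq in Hmain by nra.
  simpl in Hmain.
  unfold coefficient_bound. apply Rle_div_r; [exact Hpos|]. lra.
Qed.

(** * Sharpness: the extremal functions *)

(* The two normed modules on [C] carry different uniform structures but the
   same norm. *)
Lemma is_derive_AbsRing_C (f : C -> C) (z l : C) :
  is_derive (K := C_AbsRing) (V := AbsRing_NormedModule C_AbsRing) f z l ->
  is_derive (K := C_AbsRing) (V := C_NormedModule) f z l.
Proof.
  intros [_ H]. split; [apply is_linear_scal_l|exact H].
Qed.

Lemma C_is_derive_id (z : C) :
  is_derive (K := C_AbsRing) (V := C_NormedModule) (fun w : C => w) z (RtoC 1).
Proof.
  exact (is_derive_AbsRing_C _ _ _ (is_derive_id (K := C_AbsRing) z)).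
Qed.

Lemma is_derive_Cpow (n : nat) (z : C) :
  is_derive (K := C_AbsRing) (V := AbsRing_NormedModule C_AbsRing) (fun w => Cpow w (S n)) z
    (INR (S n) * Cpow z n)%C.
Proof.
  induction n as [|n IH].
  - apply (is_derive_ext (K := C_AbsRing) (fun w => w));
      [intros w; symmetry; apply Cpow_1_r|].
    replace (_ * _)%C with (RtoC 1) by (simpl; ring).
    apply (is_derive_id (K := C_AbsRing)).
  - assert (H := is_derive_mult (K := C_AbsRing) _ _ z _ _ (is_derive_id z) IH Cmult_comm).
    replace (INR (S (S n)) * Cpow z (S n))%C
      with (plus (mult one (Cpow z (S n))) (mult z (INR (S n) * Cpow z n)%C)); [exact H|].
    change (1 * Cpow z (S n) + z * (INR (S n) * Cpow z n) = INR (S (S n)) * Cpow z (S n))%C.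
    rewrite (S_INR (S n)), RtoC_plus, Cpow_S. ring.
Qed.

(** Reading the monomial as a scalar power times the fixed vector [e] lets [is_derive_scal_l] pass
    from the module of the ring over itself to [C_NormedModule]. *)
Lemma is_derive_monomial (e : C) (n : nat) (z : C) :
  is_derive (K := C_AbsRing) (V := C_NormedModule) (fun w : C => (e * Cpow w (S n))%C) z
    (e * INR (S n) * Cpow z n)%C.
Proof.
  replace (e * INR (S n) * Cpow z n)%C with (scal (INR (S n) * Cpow z n)%C e)
    by (change (INR (S n) * Cpow z n * e = e * INR (S n) * Cpow z n)%C; ring).
  apply (is_derive_ext (K := C_AbsRing) (V := C_NormedModule) (fun w => scal (Cpow w (S n)) e)).
  - intros w. apply Cmult_comm.
  - apply (is_derive_scal_l (K := C_AbsRing) (V := C_NormedModule)), is_derive_Cpow.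
Qed.

Lemma diff_op_id (alpha : R) (z : C) : diff_op alpha (fun w => w) z = RtoC (1 - alpha).
Proof.
  assert (E : forall w, C_derive (fun w => w) w = RtoC 1).
  { intros w. apply is_C_derive_unique, C_is_derive_id. }
  unfold diff_op. rewrite E, RtoC_minus.
  rewrite (is_C_derive_unique _ z (RtoC 0)); [ring|].
  apply (is_derive_ext (K := C_AbsRing) (V := C_NormedModule) (fun _ => RtoC 1));
    [intros w; symmetry; apply E|].
  apply (is_derive_const (K := C_AbsRing) (V := C_NormedModule)).
Qed.

(** With [n = m + 2], the identity is [(1 - alpha) * n + alpha * n * (n - 1) = n + alpha * n * (n -
    2)]. Writing [m + 2] avoids truncated subtraction in the exponents. *)
Lemma diff_op_monomial (alpha : R) (e : C) (m : nat) (z : C) :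
  diff_op alpha (fun w => (e * Cpow w (m + 2))%C) z =
  (e * RtoC (INR (m + 2) + alpha * INR (m + 2) * (INR (m + 2) - 2)) * Cpow z (m + 1))%C.
Proof.
  replace (m + 2)%nat with (S (S m)) by lia. replace (m + 1)%nat with (S m) by lia.
  unfold diff_op.
  rewrite (is_C_derive_unique _ z _ (is_derive_monomial e (S m) z)).
  rewrite (is_C_derive_unique _ z (e * INR (S (S m)) * INR (S m) * Cpow z m)%C).
  - rewrite RtoC_plus, !RtoC_mult, RtoC_minus, !S_INR, !RtoC_plus, Cpow_S. ring.
  - eapply is_derive_ext; [|apply is_derive_monomial].
    intros w. symmetry. apply is_C_derive_unique, is_derive_monomial.
Qed.

Lemma extremal_decomposition (alpha M : R) (m : nat) :
  canonical_decomposition (extremal alpha M (m + 2)) (fun z => z)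
    (fun z => (coefficient_bound alpha M (m + 2) * Cpow z (m + 2))%C).
Proof.
  set (e := coefficient_bound alpha M (m + 2)).
  split; [|split; [|split; [|split; [|split]]]].
  - intros z _. eexists. apply C_is_derive_id.
  - intros z _. replace (m + 2)%nat with (S (m + 1)) by lia. eexists. apply is_derive_monomial.
  - intros z _. unfold extremal. fold e. rewrite Cmult_conj. f_equal. f_equal.
    apply injective_projections; simpl; ring.
  - reflexivity.
  - apply is_C_derive_unique, C_is_derive_id.
  - replace (m + 2)%nat with (S (m + 1)) by lia. rewrite Cpow_S. ring.
Qed.

(** The coefficient cancels the denominator, so the analytic side is [1 - alpha] and the other
    modulus is [(M - alpha + 1) * Cmod z ^ (m + 1)]. This is strictly below [M - alpha + 1], which
    is positive because [alpha <= 1]. *)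
Lemma extremal_class_PH0 (alpha M : R) (m : nat) :
  0 < M -> 0 < alpha <= 1 -> class_PH0 alpha M (extremal alpha M (m + 2)).
Proof.
  intros HM Ha.
  exists (fun z => z), (fun z => (coefficient_bound alpha M (m + 2) * Cpow z (m + 2))%C).
  split; [apply extremal_decomposition|]. split.
  - replace (m + 2)%nat with (S (S m)) by lia.
    rewrite (is_C_derive_unique _ _ _ (is_derive_monomial _ (S m) 0)), Cpow_S. ring.
  - intros z Hz. rewrite diff_op_id, diff_op_monomial.
    assert (Hpos := coefficient_denominator_pos alpha (m + 2) (proj1 Ha) ltac:(lia)).
    rewrite <- RtoC_mult.
    replace (coefficient_bound alpha M (m + 2) * _) with (M - alpha + 1)
      by (unfold coefficient_bound; field; lra).
    rewrite Cmod_mult, Cmod_R, Cmod_pow, Rabs_pos_eq by lra.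
    unfold in_disk in Hz. assert (Hz0 := Cmod_ge_0 z).
    assert (Cmod z ^ (m + 1) < 1).
    { rewrite Nat.add_1_r. apply pow_lt_1_compat; [lra|lia]. }
    change (Re (1 - alpha)%R) with (1 - alpha). nra.
Qed.

Lemma extremal_sharp (alpha M : R) (m : nat) :
  0 < M -> 0 < alpha <= 1 ->
  exists (h g : C -> C) (a b : nat -> C),
    decomposition_with_coefficients (extremal alpha M (m + 2)) h g a b /\
    Cmod (b (m + 2)%nat) = coefficient_bound alpha M (m + 2).
Proof.
  intros HM Ha.
  set (e := coefficient_bound alpha M (m + 2)).
  exists (fun z => z), (fun z => (e * Cpow z (m + 2))%C), (fun _ => RtoC 0),
    (fun j => if Nat.eqb j (m + 2) then RtoC e else RtoC 0).
  split; [split; [apply extremal_decomposition|split]|].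
  (* The zero sum is written as its own term of index 0 to fit [C_is_series_single]. *)
  - intros z _. replace (z - z)%C with (0 * Cpow z (0 + 2))%C by ring.
    apply (C_is_series_single (fun j => 0 * Cpow z (j + 2))%C 0). intros; ring.
  - intros z _. replace (e * Cpow z (m + 2))%C
      with ((if Nat.eqb (m + 2) (m + 2) then RtoC e else RtoC 0) * Cpow z (m + 2))%C
      by (rewrite Nat.eqb_refl; reflexivity).
    (* The series starts at exponent 2, so the exponent [m + 2] has index [m]. *)
    apply (C_is_series_single
      (fun j => (if Nat.eqb (j + 2) (m + 2) then RtoC e else RtoC 0) * Cpow z (j + 2))%C m).
    intros j Hj. replace (Nat.eqb (j + 2) (m + 2)) with false; [ring|].
    symmetry. apply Nat.eqb_neq. lia.
  - rewrite Nat.eqb_refl, Cmod_R. apply Rabs_pos_eq.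
    apply Rdiv_le_0_compat; [lra|]. apply coefficient_denominator_pos; [lra|lia].
Qed.

Theorem theorem2p1 :
  forall alpha M : R, 0 < M -> 0 < alpha <= 1 ->
    (forall (f h g : C -> C) (a b : nat -> C),
        class_PH0 alpha M f ->
        decomposition_with_coefficients f h g a b ->
        forall n : nat, (2 <= n)%nat ->
          Cmod (b n) <= coefficient_bound alpha M n)
    /\
    (forall n : nat, (2 <= n)%nat ->
        class_PH0 alpha M (extremal alpha M n) /\
        exists (h g : C -> C) (a b : nat -> C),
          decomposition_with_coefficients (extremal alpha M n) h g a b /\
          Cmod (b n) = coefficient_bound alpha M n).
Proof.
  intros alpha M HM Ha. split.
  - intros f h g a b Hf Hdec n Hn.
    exact (class_PH0_coefficient_bound alpha M f h g a b n (proj1 Ha) Hf Hdec Hn).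
  - intros n Hn. replace n with ((n - 2) + 2)%nat by lia.
    split; [apply extremal_class_PH0|apply extremal_sharp]; assumption.
Qed.
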